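(* Let $R$ be a local ring of prime characteristic $p$, let $I$ be an ideal of $R$, and let $x\in I$ be a regular element. Let $i\ge 0$ be such that for all $e\geq 0$ the map $H^i_I(R/x^{p^e}R)\to H^i_I(R/xR)$, induced by the natural surjection $R/x^{p^e}R\to R/xR$, is surjective. Then the multiplication map $H^{i+1}_I(R)\xrightarrow{\times x}H^{i+1}_I(R)$ is surjective.
   Context: All rings are commutative, noetherian, with unity. $H^i_I(-)$ denotes local cohomology with support in $I$. A regular element is a nonzerodivisor. *)

(* Defs.v *)
From HB Require Import structures.
From mathcomp Require Import all_boot all_order all_algebra.
From mathcomp Require Import boolp classical_sets functions.

Set Implicit Arguments.
Unset Strict Implicit.
Unset Printing Implicit Defensive.
Import Order.TTheory GRing.Theory Num.Theory.
Local Open Scope classical_set_scope.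
Local Open Scope ring_scope.

Definition surjective (A B : Type) (f : A -> B) : Prop :=
  forall y : B, exists x : A, f x = y.

Record subm (R : pzRingType) (M : lmodType R) (S : submodClosed M) : Type :=
  Subm { subm_val : M; _ : subm_val \in S }.

Section Subm.
Variables (R : pzRingType) (M : lmodType R) (S : submodClosed M).
HB.instance Definition _ := [isSub for @subm_val R M S].
HB.instance Definition _ := [Choice of subm S by <:].
HB.instance Definition _ := [SubChoice_isSubLmodule of subm S by <:].
End Subm.

(* submodClosed does not inherit from zmodClosed, which Quotient.quot needs *)
Section SubmZmod.
Variables (R : pzRingType) (M : lmodType R) (S : submodClosed M).
Definition submp : {pred M} := fun m => m \in S.
Lemma submp_zmod_closed : zmod_closed submp.
Proof. exact: (GRing.submod_closedB (submodClosedP S)). Qed.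
HB.instance Definition _ := GRing.isZmodClosed.Build M submp submp_zmod_closed.
End SubmZmod.

Definition quotm (R : pzRingType) (M : lmodType R) (S : submodClosed M) : Type :=
  Quotient.quot (submp S).

Section Quotm.
Variables (R : pzRingType) (M : lmodType R) (S : submodClosed M).
Local Notation Q := (quotm S).
HB.instance Definition _ := GRing.Zmodule.copy Q (Quotient.quot (submp S)).

Definition qcls (m : M) : Q := \pi_(Quotient.quot (submp S))%qT m.

Lemma qclsP (x y : M) : qcls x = qcls y <-> x - y \in S.
Proof.
have -> : (x - y \in S) = (x - y \in submp S) by [].
by rewrite Quotient.idealrBE; split=> /eqP.
Qed.

Lemma qcls_surj : surjective qcls.
Proof. by move=> u; exists (repr u); rewrite /qcls reprK. Qed.

Lemma qclsB : zmod_morphism qcls.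
Proof. by move=> x y; rewrite /qcls raddfB. Qed.

HB.instance Definition _ := GRing.isZmodMorphism.Build M Q qcls qclsB.

Lemma qcls_eq0 (x : M) : qcls x = 0 <-> x \in S.
Proof. by rewrite -(raddf0 qcls) qclsP subr0. Qed.

Definition qscale (a : R) (u : Q) : Q := qcls (a *: repr (u : Quotient.quot (submp S))).

Lemma qscaleE a m : qscale a (qcls m) = qcls (a *: m).
Proof.
apply/qclsP; rewrite -scalerBr rpredZ //; apply/qclsP.
by rewrite /qcls reprK.
Qed.

Lemma qscaleA a b v : qscale a (qscale b v) = qscale (a * b) v.
Proof. by have [m <-] := qcls_surj v; rewrite !qscaleE scalerA. Qed.
Lemma qscale1 : left_id 1 qscale.
Proof. by move=> v; have [m <-] := qcls_surj v; rewrite qscaleE scale1r. Qed.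
Lemma qscaleDr : right_distributive qscale +%R.
Proof.
move=> a u v; have [m <-] := qcls_surj u; have [n <-] := qcls_surj v.
by rewrite -raddfD !qscaleE scalerDr raddfD.
Qed.
Lemma qscaleDl v : {morph qscale^~ v : a b / a + b}.
Proof.
by move=> a b; have [m <-] := qcls_surj v; rewrite !qscaleE scalerDl raddfD.
Qed.

HB.instance Definition _ :=
  GRing.Zmodule_isLmodule.Build R Q qscaleA qscale1 qscaleDr qscaleDl.

Lemma qclsZ : scalable qcls.
Proof. by move=> a m; rewrite -qscaleE. Qed.
HB.instance Definition _ := GRing.isScalable.Build R M Q *:%R qcls qclsZ.

End Quotm.
Arguments qcls {R M} S m.

Section QuotLift.
Variables (R : pzRingType) (M N : lmodType R) (S : submodClosed M).
Variables (f : {linear M -> N}) (fS : forall m, m \in S -> f m = 0).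

Definition qlift_of of (forall m, m \in S -> f m = 0) : quotm S -> N :=
  fun u => f (repr (u : Quotient.quot (submp S))).
Local Notation qlift := (qlift_of fS).

Lemma qlift_cls m : qlift (qcls S m) = f m.
Proof.
apply/eqP; rewrite -subr_eq0 -linearB; apply/eqP/fS/qclsP.
by rewrite /qcls reprK.
Qed.

Lemma qlift_linear : linear qlift.
Proof.
move=> a u v; have [m <-] := qcls_surj u; have [n <-] := qcls_surj v.
by rewrite -linearP !qlift_cls linearP.
Qed.
HB.instance Definition _ :=
  GRing.isLinear.Build R (quotm S) N *:%R qlift qlift_linear.

Definition qlift_lin : {linear quotm S -> N} := qlift.
Lemma qlift_linE m : qlift_lin (qcls S m) = f m.
Proof. exact: qlift_cls. Qed.
End QuotLift.

Section QuotMap.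
Variables (R : pzRingType) (M N : lmodType R).
Variables (S : submodClosed M) (T : submodClosed N) (f : {linear M -> N}).
Variable fST : forall m, m \in S -> f m \in T.

Lemma qmap_subproof m : m \in S -> (qcls T \o f) m = 0.
Proof. by move=> /fST/qcls_eq0. Qed.

Definition qmap : {linear quotm S -> quotm T} := qlift_lin qmap_subproof.

Lemma qmap_cls m : qmap (qcls S m) = qcls T (f m).
Proof. exact: qlift_cls. Qed.
End QuotMap.

Section SubMap.
Variables (R : pzRingType) (M N : lmodType R).
Variables (S : submodClosed M) (T : submodClosed N) (f : {linear M -> N}).
Hypothesis fST : forall m, m \in S -> f m \in T.

Definition smap_of of (forall m, m \in S -> f m \in T) : subm S -> subm T :=
  fun u => Subm (fST (valP u)).
Local Notation smap' := (smap_of fST).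

Lemma smap_linear : linear smap'.
Proof. by move=> a u v; apply: val_inj => /=; rewrite linearP. Qed.
HB.instance Definition _ :=
  GRing.isLinear.Build R (subm S) (subm T) *:%R smap' smap_linear.
Definition smap : {linear subm S -> subm T} := smap'.

Lemma smapE u : val (smap u) = f (val u).
Proof. by []. Qed.
End SubMap.

Section KerImg.
Variables (R : pzRingType) (M N : lmodType R) (f : {linear M -> N}).

Definition kerp : {pred M} := fun m => f m == 0.
Lemma kerp_closed : submod_closed kerp.
Proof.
split=> [|a u v]; rewrite !unfold_in /= ?linear0 // => /eqP fu /eqP fv.
by rewrite linearP fu fv scaler0 addr0.
Qed.
HB.instance Definition _ := GRing.isSubmodClosed.Build R M kerp kerp_closed.

Definition imgp : {pred N} := fun n => `[< exists m, f m = n >].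
Lemma imgp_closed : submod_closed imgp.
Proof.
split=> [|a u v]; rewrite !unfold_in /=; first by apply/asboolP; exists 0; rewrite linear0.
move=> /asboolP[x <-] /asboolP[y <-]; apply/asboolP.
by exists (a *: x + y); rewrite linearP.
Qed.
HB.instance Definition _ := GRing.isSubmodClosed.Build R N imgp imgp_closed.
End KerImg.

Definition ker (R : pzRingType) (M N : lmodType R) (f : {linear M -> N}) :
  submodClosed M := kerp f.
Definition img (R : pzRingType) (M N : lmodType R) (f : {linear M -> N}) :
  submodClosed N := imgp f.

Lemma kerP (R : pzRingType) (M N : lmodType R) (f : {linear M -> N}) m :
  m \in ker f <-> f m = 0.
Proof. by rewrite unfold_in; split=> /eqP. Qed.
Lemma imgP (R : pzRingType) (M N : lmodType R) (f : {linear M -> N}) n :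
  n \in img f <-> exists m, f m = n.
Proof. by rewrite unfold_in; split=> /asboolP. Qed.

(* The ideals of R are the submodules of R^o, i.e. the I : submodClosed R^o *)

Section Ideals.
Variable R : comNzRingType.

Definition noetherian : Prop :=
  forall J : submodClosed R^o, exists s : seq R,
    forall y : R, y \in J <->
      exists c : 'I_(size s) -> R, y = \sum_(k < size s) c k * s`_k.

Definition maximal_ideal (m : submodClosed R^o) : Prop :=
  (1 : R) \notin m /\
  forall J : submodClosed R^o,
    {subset m <= J} -> (1 : R) \notin J -> {subset J <= m}.

Definition local_ring : Prop :=
  exists2 m : submodClosed R^o, maximal_ideal m &
    forall m' : submodClosed R^o, maximal_ideal m' -> m' =i m.

Definition regular_elt (x : R) : Prop := forall y : R, x * y = 0 -> y = 0.

Section Principal.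
Variable x : R.
Definition principalp : {pred R^o} := fun y => `[< exists c : R, y = c * x >].
Lemma principalp_closed : submod_closed principalp.
Proof.
split=> [|a u v]; rewrite !unfold_in /=; first by apply/asboolP; exists 0; rewrite mul0r.
move=> /asboolP[c ->] /asboolP[d ->]; apply/asboolP.
by exists (a * c + d); rewrite mulrDl -mulrA.
Qed.
HB.instance Definition _ :=
  GRing.isSubmodClosed.Build R R^o principalp principalp_closed.
End Principal.
Definition principal (x : R) : submodClosed R^o := principalp x.

Definition quot_by (x : R) : lmodType R := quotm (principal x).

Lemma principal_pchar (p : nat) (pR : p \in [pchar R]) (x : R) (e : nat) y :
  y \in principal (x ^+ (p ^ e)) -> y \in principal x.
Proof.
rewrite !unfold_in => /asboolP[c ->]; apply/asboolP.
have : (0 < p ^ e)%N by rewrite expn_gt0 prime_gt0 // (pcharf_prime pR).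
by case: (p ^ e)%N => // n _; exists (c * x ^+ n); rewrite exprSr mulrA.
Qed.

Definition frob_proj (p : nat) (pR : p \in [pchar R]) (x : R) (e : nat) :
    {linear quot_by (x ^+ (p ^ e)) -> quot_by x} :=
  @qmap R R^o R^o (principal (x ^+ (p ^ e))) (principal x) idfun
    (@principal_pchar p pR x e).

Lemma frob_proj_cls (p : nat) (pR : p \in [pchar R]) (x : R) (e : nat) (r : R^o) :
  frob_proj pR x e (qcls (principal (x ^+ (p ^ e))) r) = qcls (principal x) r.
Proof. exact: qmap_cls. Qed.

Definition ideal_mul (A B : set R) : set R :=
  [set r | exists2 s : seq (R * R),
     (forall ab, ab \in s -> A ab.1 /\ B ab.2) &
     r = \sum_(ab <- s) ab.1 * ab.2].

Definition ideal_pow (A : set R) (n : nat) : set R := iter n (ideal_mul A) setT.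

End Ideals.

Section Gamma.
Variables (R : comNzRingType) (I : submodClosed R^o).
Local Notation "I ^^ n" := (ideal_pow [set y : R | y \in I] n) (at level 30).

Lemma ideal_pow_le m n : (m <= n)%N -> I ^^ n `<=` I ^^ m.
Proof.
have S k : I ^^ k.+1 `<=` I ^^ k.
  elim: k => [|k IH] // r [s sP ->]; exists s => // ab /sP[? ?].
  by split => //; apply: IH.
move=> /subnK <-; elim: (n - m)%N => // k IH.
by rewrite addSn => r /S; apply: IH.
Qed.

Section GammaObj.
Variable M : lmodType R.

(* m is killed by some power of I *)
Definition gammap : {pred M} :=
  fun m => `[< exists n : nat, forall a : R, (I ^^ n) a -> a *: m = 0 >].

Lemma gammap_closed : submod_closed gammap.
Proof.
split=> [|a u v]; rewrite !unfold_in /=.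
  by apply/asboolP; exists 0 => a _; rewrite scaler0.
move=> /asboolP[n1 h1] /asboolP[n2 h2]; apply/asboolP; exists (n1 + n2)%N => b Ib.
rewrite scalerDr scalerA mulrC -scalerA h1 ?h2 ?scaler0 ?addr0 //.
- by apply: (ideal_pow_le _ Ib); rewrite leq_addl.
- by apply: (ideal_pow_le _ Ib); rewrite leq_addr.
Qed.
HB.instance Definition _ := GRing.isSubmodClosed.Build R M gammap gammap_closed.

Definition gamma_sub : submodClosed M := gammap.
Definition gamma : lmodType R := subm gamma_sub.
End GammaObj.

Section GammaMap.
Variables (M N : lmodType R) (f : {linear M -> N}).
Lemma gamma_map_subproof m : m \in gamma_sub M -> f m \in gamma_sub N.
Proof.
rewrite !unfold_in => /asboolP[n h]; apply/asboolP; exists n => a /h e.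
by rewrite -linearZ /= e linear0.
Qed.
Definition gamma_map : {linear gamma M -> gamma N} := smap gamma_map_subproof.
End GammaMap.
End Gamma.

Record complex (R : pzRingType) := Complex {
  obj :> nat -> lmodType R;
  diff : forall n, {linear obj n -> obj n.+1};
  diffK : forall n (z : obj n), diff n.+1 (diff n z) = 0 }.
Arguments diff {R} c n.

Record cmap (R : pzRingType) (C D : complex R) := CMap {
  cmor :> forall n, {linear C n -> D n};
  cmorE : forall n (z : C n), cmor n.+1 (diff C n z) = diff D n (cmor n z) }.

Section Cohomology.
Variable R : pzRingType.

Definition cocycles (C : complex R) (n : nat) : lmodType R := subm (ker (diff C n)).

Section Obj.
Variable C : complex R.

(* degree n.+1 coboundaries are the image of diff C n, degree 0 ones are 0 *)
Definition is_cobound (n : nat) : C n -> Prop :=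
  match n return C n -> Prop with
  | 0%N => fun z => z = 0
  | n'.+1 => fun z => exists y, diff C n' y = z
  end.

Definition coboundp (n : nat) : {pred cocycles C n} :=
  fun z => `[< is_cobound (val z) >].
Lemma coboundp_closed n : submod_closed (@coboundp n).
Proof.
split=> [|a u v]; rewrite !unfold_in /=.
  by apply/asboolP; case: n => //= n; exists 0; rewrite linear0.
move=> /asboolP hu /asboolP hv; apply/asboolP.
case: n u v hu hv => [|n] u v /=; first by move=> -> ->; rewrite scaler0 addr0.
by move=> [x <-] [y <-]; exists (a *: x + y); rewrite linearP.
Qed.
HB.instance Definition _ n :=
  GRing.isSubmodClosed.Build R (cocycles C n) (@coboundp n) (@coboundp_closed n).
Definition cobound n : submodClosed (cocycles C n) := @coboundp n.

Definition cohom (n : nat) : lmodType R := quotm (cobound n).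
End Obj.

Lemma is_cobound_map (C D : complex R) (f : cmap C D) n (z : C n) :
  is_cobound z -> is_cobound (f n z).
Proof.
case: n z => [|n] z /=; first by move=> ->; rewrite linear0.
by move=> [y <-]; exists (f n y); rewrite -cmorE.
Qed.

Section Map.
Variables (C D : complex R) (f : cmap C D) (n : nat).

Lemma cocycle_map_subproof z :
  z \in ker (diff C n) -> f n z \in ker (diff D n).
Proof. by move=> /kerP h; apply/kerP; rewrite -cmorE h linear0. Qed.
Definition cocycle_map : {linear cocycles C n -> cocycles D n} :=
  smap cocycle_map_subproof.

Lemma cohom_map_subproof z : z \in cobound C n -> cocycle_map z \in cobound D n.
Proof.
rewrite !unfold_in => /asboolP h; apply/asboolP.
exact: (@is_cobound_map C D f n (val z) h).
Qed.
Definition cohom_map : {linear cohom C n -> cohom D n} := qmap cohom_map_subproof.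
End Map.
End Cohomology.

Section GammaComplex.
Variables (R : comNzRingType) (I : submodClosed R^o).

Lemma gamma_diffK (C : complex R) n (z : gamma I (C n)) :
  gamma_map I (diff C n.+1) (gamma_map I (diff C n) z) = 0.
Proof. by apply: val_inj; rewrite /= diffK. Qed.
Definition gamma_complex (C : complex R) : complex R :=
  @Complex R (fun n => gamma I (C n)) (fun n => gamma_map I (diff C n)) (@gamma_diffK C).

Lemma gamma_cmorE (C D : complex R) (f : cmap C D) n (z : gamma_complex C n) :
  gamma_map I (f n.+1) (diff (gamma_complex C) n z) =
  diff (gamma_complex D) n (gamma_map I (f n) z).
Proof. by apply: val_inj; rewrite /= cmorE. Qed.
Definition gamma_cmap (C D : complex R) (f : cmap C D) :
  cmap (gamma_complex C) (gamma_complex D) :=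
  @CMap R (gamma_complex C) (gamma_complex D) (fun n => gamma_map I (f n))
    (@gamma_cmorE C D f).
End GammaComplex.

Definition injective_module (R : pzRingType) (E : lmodType R) : Prop :=
  forall (A B : lmodType R) (i : {linear A -> B}) (f : {linear A -> E}),
    injective i -> exists g : {linear B -> E}, forall a, g (i a) = f a.

Record injective_resolution (R : pzRingType) (M : lmodType R) := InjRes {
  ires :> complex R;
  iaug : {linear M -> ires 0%N};
  iaug_inj : injective iaug;
  iaug_exact : forall z, diff ires 0 z = 0 <-> exists m, iaug m = z;
  ires_exact : forall n z, diff ires n.+1 z = 0 <-> exists y, diff ires n y = z;
  ires_inj : forall n, injective_module (ires n) }.
Arguments iaug {R M} i.
Arguments ires_inj {R M} i n.

Section Extend.
Variables (R : pzRingType) (A B E : lmodType R).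
Variables (g : {linear A -> B}) (h : {linear A -> E}).

Lemma injective_extend : injective_module E ->
  (forall a, g a = 0 -> h a = 0) ->
  exists k : {linear B -> E}, forall a, k (g a) = h a.
Proof.
move=> Einj gh.
have h0 a : a \in ker g -> h a = 0 by move/kerP/gh.
have g0 a : a \in ker g -> g a = 0 by move/kerP.
have inj : injective (qlift_lin g0).
  move=> u v; have [a <-] := qcls_surj u; have [b <-] := qcls_surj v.
  rewrite !qlift_linE => e; apply/qclsP/kerP.
  by rewrite linearB e subrr.
have [k kP] := Einj _ _ (qlift_lin g0) (qlift_lin h0) inj.
by exists k => a; have := kP (qcls (ker g) a); rewrite !qlift_linE.
Qed.
End Extend.

Section Comparison.
Variables (R : pzRingType) (M N : lmodType R) (f : {linear M -> N}).
Variables (E : injective_resolution M) (F : injective_resolution N).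

Definition is_lift (phi : cmap E F) : Prop :=
  forall m, phi 0%N (iaug E m) = iaug F (f m).

Let K n (phi : {linear E n -> F n}) : Prop :=
  forall z, diff E n z = 0 -> diff F n (phi z) = 0.

Let lift0 : exists phi : {linear E 0%N -> F 0%N},
  K phi /\ forall m, phi (iaug E m) = iaug F (f m).
Proof.
have [|k kP] := @injective_extend _ _ _ _ (iaug E) (iaug F \o f) (ires_inj F 0).
  by move=> m e; rewrite /= (iaug_inj (etrans e (esym (linear0 _)))) !linear0.
exists k; split=> // z /iaug_exact[m <-].
by rewrite kP; apply/iaug_exact; exists (f m).
Qed.

Let liftS n (phi : {linear E n -> F n}) : K phi ->
  exists psi : {linear E n.+1 -> F n.+1},
    K psi /\ forall z, psi (diff E n z) = diff F n (phi z).
Proof.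
move=> Kphi.
have [k kP] := @injective_extend _ _ _ _ (diff E n) (diff F n \o phi)
  (ires_inj F n.+1) Kphi.
exists k; split=> // z /ires_exact[y <-].
by rewrite kP diffK.
Qed.

Lemma lift_exists : exists phi : cmap E F, is_lift phi.
Proof.
have [phi0 [K0 phi0E]] := cid lift0.
pose T n := {phi : {linear E n -> F n} | K phi}.
pose step n (t : T n) : T n.+1 :=
  exist _ (projT1 (cid (liftS (proj2_sig t))))
    (projT2 (cid (liftS (proj2_sig t)))).1.
pose s := nat_rect T (exist _ phi0 K0) step.
have sE n (z : E n) : proj1_sig (s n.+1) (diff E n z) = diff F n (proj1_sig (s n) z).
  exact: (projT2 (cid (liftS (proj2_sig (s n))))).2.
by exists (CMap sE).
Qed.

Definition lift : cmap E F := projT1 (cid lift_exists).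
Lemma liftP : is_lift lift.
Proof. exact: (projT2 (cid lift_exists)). Qed.
End Comparison.
Section QZ.
Definition ratintp : {pred rat} := fun q => `[< exists k : int, q = k%:~R >].
Lemma ratintp_closed : zmod_closed ratintp.
Proof.
split=> [|u v]; rewrite !unfold_in /=; first by apply/asboolP; exists 0.
move=> /asboolP[k ->] /asboolP[l ->]; apply/asboolP.
by exists (k - l); rewrite rmorphB.
Qed.
HB.instance Definition _ := GRing.isZmodClosed.Build rat ratintp ratintp_closed.

Definition QZ : zmodType := Quotient.quot ratintp.

Definition qz (q : rat) : QZ := \pi_(Quotient.quot ratintp)%qT q.
Lemma qz_additive : zmod_morphism qz.
Proof. by move=> x y; rewrite /qz raddfB. Qed.
HB.instance Definition _ := GRing.isZmodMorphism.Build rat QZ qz qz_additive.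

Lemma qz_eq0 q : qz q = 0 <-> exists k : int, q = k%:~R.
Proof.
rewrite -(raddf0 qz) /qz; split=> [/eqP|[k e]].
  by rewrite -Quotient.idealrBE subr0 unfold_in => /asboolP.
by apply/eqP; rewrite -Quotient.idealrBE subr0 unfold_in; apply/asboolP; exists k.
Qed.

Lemma qz_div (y : QZ) n : (0 < n)%N -> exists z, z *+ n = y.
Proof.
move=> n0; exists (qz (repr y / n%:R)).
have e : repr y / n%:R *+ n = repr y.
  by rewrite -[LHS]mulr_natr divfK // pnatr_eq0 -lt0n.
by rewrite -raddfMn e; apply: reprK.
Qed.
End QZ.

Section Baer.
Variables (B D : zmodType).
Hypothesis Ddiv : forall (y : D) n, (0 < n)%N -> exists z, z *+ n = y.

Definition pfun (G : set (B * D)) : Prop :=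
  (forall u v, G u -> G v -> G (u - v)) /\ (forall y, G (0, y) -> y = 0).

Section Closure.
Variable G : set (B * D).
Hypothesis PG : pfun G.

Lemma pfun0 u : G u -> G 0.
Proof. by move=> Gu; rewrite -(subrr u); apply: PG.1. Qed.
Lemma pfunN u : G u -> G (- u).
Proof. by move=> Gu; rewrite -sub0r; apply: PG.1 => //; apply: pfun0 Gu. Qed.
Lemma pfunD u v : G u -> G v -> G (u + v).
Proof. by move=> Gu Gv; rewrite -(opprK v); apply: PG.1 => //; apply: pfunN. Qed.
Lemma pfunMn u n : G u -> G (u *+ n).
Proof.
move=> Gu; elim: n => [|n IH]; first exact: pfun0 Gu.
by rewrite mulrS; apply: pfunD.
Qed.
Lemma pfunMz u (k : int) : G u -> G (u *~ k).
Proof.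
by move=> Gu; case: k => n; [|apply: pfunN]; apply: pfunMn.
Qed.
Lemma pfun_fun b y y' : G (b, y) -> G (b, y') -> y = y'.
Proof.
move=> G1 G2; apply/eqP; rewrite -subr_eq0; apply/eqP/PG.2.
by rewrite -(subrr b); apply: (PG.1 _ _ G1 G2).
Qed.

Lemma pair_mulz (b : B) (y : D) (k : int) : (b, y) *~ k = (b *~ k, y *~ k).
Proof.
have H n : (b, y) *+ n = (b *+ n, y *+ n).
  by elim: n => // n IH; rewrite !mulrS IH.
by case: k => n; rewrite /intmul H.
Qed.

Lemma pfun_step (b : B) : G 0 -> exists z : D, forall (k : int) y,
  G (b *~ k, y) -> y = z *~ k.
Proof.
move=> G0.
pose P n := `[< (0 < n)%N /\ exists y, G (b *+ n, y) >].
have [exP|nP] := pselect (exists n, P n); last first.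
  exists 0 => k y Gky; rewrite mul0rz.
  have [k0|k0] := eqVneq k 0; first by apply: PG.2; rewrite k0 mulr0z in Gky.
  exfalso; apply: nP; exists `|k|%N; apply/asboolP; rewrite absz_gt0; split=> //.
  have [kp|kn] := leP 0 k.
    by exists y; rewrite pmulrn gez0_abs.
  exists (- y); rewrite pmulrn ltz0_abs // mulrNz.
  exact: (pfunN Gky).
case: (ex_minnP exP) => n /asboolP[n0 [y0 Gy0]] nmin.
have [z zn] := Ddiv y0 n0.
exists z => k y Gky.
pose q := (k %/ n%:Z)%Z; pose r := (k %% n%:Z)%Z.
have kE : k = q * n%:Z + r by rewrite /q /r -divz_eq.
have nz : n%:Z != 0 by rewrite eqz_nat -lt0n.
have r0 : 0 <= r by rewrite /r modz_ge0.
have rn : r < n%:Z by rewrite /r ltz_mod // lt0n.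
have Gq : G (b *~ (q * n%:Z), y0 *~ q).
  rewrite mulrC mulrzA -pair_mulz; apply: pfunMz; by rewrite -pmulrn.
have Gr : G (b *~ r, y - y0 *~ q).
  have -> : b *~ r = b *~ k - b *~ (q * n%:Z) by rewrite -mulrzBr kE addrAC subrr add0r.
  exact: (PG.1 _ _ Gky Gq).
have r00 : r = 0.
  apply/eqP; apply: contraT => rne.
  have : P `|r|%N.
    apply/asboolP; rewrite absz_gt0; split=> //; exists (y - y0 *~ q).
    by rewrite pmulrn gez0_abs.
  by move/nmin; rewrite -lez_nat gez0_abs // leNgt rn.
move: Gr; rewrite r00 mulr0z => /PG.2/eqP; rewrite subr_eq0 => /eqP ->.
by rewrite kE r00 addr0 mulrC mulrzA -pmulrn zn.
Qed.
End Closure.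

Lemma pfun_extend (G0 : set (B * D)) : pfun G0 -> G0 0 ->
  exists g : {additive B -> D}, forall u, G0 u -> g u.1 = u.2.
Proof.
move=> P0 G00.
have [F FF tot|X [PX Xmax]] :=
    @Zorn_bigcup (B * D)%type [set X | pfun (G0 `|` X)].
  split=> [u v|y].
    move=> [Gu|[X FX Xu]] [Gv|[Y FY Yv]].
    - by left; apply: P0.1.
    - by case: ((FF Y FY).1 u v (or_introl Gu) (or_intror Yv)); [left|right; exists Y].
    - by case: ((FF X FX).1 u v (or_intror Xu) (or_introl Gv)); [left|right; exists X].
    - have [XY|YX] := tot X Y FX FY.
        by case: ((FF Y FY).1 u v (or_intror (XY _ Xu)) (or_intror Yv));
          [left|right; exists Y].
      by case: ((FF X FX).1 u v (or_intror Xu) (or_intror (YX _ Yv)));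
        [left|right; exists X].
  move=> [Gy|[X FX Xy]]; first exact: P0.2.
  by apply: (FF X FX).2; right.
set G := G0 `|` X in PX.
have G0' : G 0 by left.
have total b : exists y, G (b, y).
  have [z zP] := pfun_step PX b G0'.
  apply: contrapT => nb.
  pose G' : set (B * D) := [set u | exists (w : B * D) (k : int), G w /\ u = w + (b, z) *~ k].
  have GG' : G `<=` G' by move=> u Gu; exists u, 0; rewrite mulr0z addr0.
  have GE : G0 `|` G' = G'.
    by rewrite setUidr // => u Gu; apply: GG'; left.
  apply: (Xmax G').
    split; first by move=> u Xu; apply: GG'; right.
    move=> /(_ (b, z)) H; apply: nb; exists z; right; apply: H.
    by exists 0, 1; rewrite add0r mulr1z.
  rewrite /= GE; split.
    move=> _ _ [u [k [Gu ->]]] [v [l [Gv ->]]]; exists (u - v), (k - l).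
    split; first exact: PX.1.
    by rewrite mulrzBr opprD addrACA.
  move=> y [[c w] [k [Gw]]]; rewrite pair_mulz => -[e ->].
  have : G (b *~ (- k), w).
    by rewrite mulrNz; have -> : - (b *~ k) = c by apply/esym/eqP; rewrite -addr_eq0 -e.
  by move/zP ->; rewrite mulrNz addrC subrr.
pose g b := projT1 (cid (total b)).
have gP b : G (b, g b) := projT2 (cid (total b)).
have gadd : zmod_morphism g.
  move=> a b; apply: (pfun_fun PX (gP _)).
  exact: (PX.1 _ _ (gP a) (gP b)).
pose gm := GRing.isZmodMorphism.Build B D g gadd.
pose ga : {additive B -> D} := HB.pack g gm.
exists ga => -[b y] Gu; apply: (pfun_fun PX (gP b)).
by left.
Qed.
End Baer.

Lemma qz_extend (A B : zmodType) (i : {additive A -> B}) (f : {additive A -> QZ}) :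
  injective i -> exists g : {additive B -> QZ}, forall a, g (i a) = f a.
Proof.
move=> inj.
pose G : set (B * QZ) := [set u | exists a, u = (i a, f a)].
have PG : pfun G.
  split=> [_ _ [a ->] [b ->]|y [a []]].
    by exists (a - b); rewrite !raddfB.
  by move=> e ->; rewrite (inj a 0) ?raddf0.
have [|g gP] := pfun_extend qz_div PG.
  by exists 0; rewrite !raddf0.
by exists g => a; apply: (gP (i a, f a)); exists a.
Qed.

Lemma qz_separates (M : zmodType) (m : M) : m != 0 ->
  exists g : {additive M -> QZ}, g m != 0.
Proof.
move=> m0.
have [q [qn0 qP]] : exists q : rat, qz q != 0 /\
    forall k : int, m *~ k = 0 -> exists l : int, k%:~R * q = l%:~R.
  have qzn n : (1 < n)%N -> qz (n%:R^-1) != 0.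
    move=> n1; apply/eqP => /qz_eq0[k e].
    have n0 : (n%:R : rat) != 0 by rewrite pnatr_eq0 -lt0n ltnW.
    have : (k * n%:Z)%:~R = 1%:~R :> rat by rewrite intrM -e mulVf.
    move/intr_inj => /(congr1 absz); rewrite abszM /= => /eqP.
    by rewrite muln_eq1 => /andP[_ /eqP nE]; rewrite nE in n1.
  pose P n := (0 < n)%N && (m *+ n == 0).
  have [exP|nP] := pselect (exists n, P n); last first.
    exists (2%:R^-1); split; first exact: qzn.
    move=> k mk; exists 0; suff -> : k = 0 by rewrite mul0r.
    apply/eqP; apply: contraT => k0; exfalso; apply: nP; exists `|k|%N.
    rewrite /P absz_gt0 k0 /=.
    by case: k mk {k0} => n /eqP //; rewrite oppr_eq0.
  case: (ex_minnP exP) => n /andP[n0 /eqP mn] nmin.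
  have n1 : (1 < n)%N.
    by case: n n0 mn {nmin} => [|[|n]] // _; rewrite mulr1n => e; rewrite e eqxx in m0.
  exists (n%:R^-1); split; first exact: qzn.
  move=> k mk.
  have nz : n%:Z != 0 by rewrite eqz_nat -lt0n.
  have r0 : 0 <= (k %% n%:Z)%Z by rewrite modz_ge0.
  have rn : (k %% n%:Z)%Z < n%:Z by rewrite ltz_mod // lt0n.
  have mr : m *~ (k %% n%:Z)%Z = 0.
    move: mk; rewrite {1}(divz_eq k n%:Z) mulrzDr mulrC mulrzA.
    by rewrite -pmulrn mn mul0rz add0r.
  have kr : (k %% n%:Z)%Z = 0.
    apply/eqP; apply: contraT => rne.
    have : P `|(k %% n%:Z)%Z|%N.
      by rewrite /P absz_gt0 rne pmulrn gez0_abs // mr eqxx.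
    by move/nmin; rewrite -lez_nat gez0_abs // leNgt rn.
  exists (k %/ n%:Z)%Z; rewrite {1}(divz_eq k n%:Z) kr addr0 intrM mulfK //.
  by rewrite intr_eq0.
pose G : set (M * QZ) := [set u | exists k : int, u = (m *~ k, qz (k%:~R * q))].
have PG : pfun G.
  split=> [_ _ [k ->] [l ->]|y [k []]].
    by exists (k - l); rewrite mulrzBr intrB mulrBl raddfB.
  by move=> e ->; apply/qz_eq0/qP.
have [|g gP] := pfun_extend qz_div PG.
  by exists 0; rewrite mulr0z mul0r raddf0.
exists g; rewrite (gP (m, qz q)) //.
by exists 1; rewrite mulr1z mul1r.
Qed.

(* The product of copies of Hom_Z(R, Q/Z) indexed by the characters M -> Q/Z,
   with (a f)(chi)(r) = f(chi)(r a): an injective R-module containing M *)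
Section Coinduced.
Variables (R : comNzRingType) (M : lmodType R).
Local Notation X := ({additive M -> QZ}).

Definition coindp : {pred (X -> R -> QZ)} :=
  fun f => `[< forall chi, zmod_morphism (f chi) >].
Lemma coindp_closed : zmod_closed coindp.
Proof.
split=> [|u v]; rewrite !unfold_in /=.
  by apply/asboolP => chi a b; rewrite /GRing.zero /= subr0.
move=> /asboolP hu /asboolP hv; apply/asboolP => chi a b.
have E c : (u - v) chi c = u chi c - v chi c by [].
by rewrite !E hu hv !opprD opprK addrACA.
Qed.
HB.instance Definition _ := GRing.isZmodClosed.Build (X -> R -> QZ) coindp coindp_closed.

Record coind : Type := Coind { coind_val : X -> R -> QZ; _ : coind_val \in coindp }.
HB.instance Definition _ := [isSub for coind_val].
HB.instance Definition _ := [Choice of coind by <:].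
HB.instance Definition _ := [SubChoice_isSubZmodule of coind by <:].

Lemma coind_add (f : coind) chi : zmod_morphism (val f chi).
Proof. by have := valP f; rewrite unfold_in => /asboolP. Qed.

Lemma coind_ext (f g : coind) : (forall chi r, val f chi r = val g chi r) -> f = g.
Proof.
move=> h; apply: val_inj; apply: functional_extensionality_dep => chi.
by apply: functional_extensionality_dep => r.
Qed.

Lemma coind_valD (f g : coind) chi r : val (f + g) chi r = val f chi r + val g chi r.
Proof. by []. Qed.

Lemma cscale_subproof (a : R) (f : coind) :
  (fun chi r => val f chi (r * a)) \in coindp.
Proof.
rewrite unfold_in; apply/asboolP => chi r s.
by rewrite mulrBl coind_add.
Qed.
Definition cscale a f := Coind (cscale_subproof a f).

Lemma cscaleA a b v : cscale a (cscale b v) = cscale (a * b) v.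
Proof. by apply: coind_ext => chi r; rewrite /= mulrA. Qed.
Lemma cscale1 : left_id 1 cscale.
Proof. by move=> v; apply: coind_ext => chi r; rewrite /= mulr1. Qed.
Lemma cscaleDr : right_distributive cscale +%R.
Proof. by move=> a u v; apply: coind_ext => chi r. Qed.
Lemma cscaleDl v : {morph cscale^~ v : a b / a + b}.
Proof.
move=> a b; apply: coind_ext => chi r; rewrite coind_valD /= mulrDr.
have -> : r * a + r * b = r * a - (- (r * b)) by rewrite opprK.
rewrite coind_add; congr (_ + _).
have : val v chi (0 - r * b) = val v chi 0 - val v chi (r * b) by rewrite coind_add.
have : val v chi (0 - 0) = val v chi 0 - val v chi 0 by rewrite coind_add.
by rewrite !sub0r oppr0 subrr => -> ->; rewrite sub0r opprK.
Qed.
HB.instance Definition _ :=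
  GRing.Zmodule_isLmodule.Build R coind cscaleA cscale1 cscaleDr cscaleDl.

Lemma coind_valZ a (f : coind) chi r : val (a *: f) chi r = val f chi (r * a).
Proof. by []. Qed.

Lemma coind_injective : injective_module coind.
Proof.
move=> A B i f inj.
have ext (chi : X) : exists g : {additive B -> QZ}, forall a, g (i a) = val (f a) chi 1.
  have add : zmod_morphism (fun a => val (f a) chi 1) by move=> a b; rewrite linearB.
  pose h : {additive A -> QZ} :=
    HB.pack (fun a => val (f a) chi 1) (GRing.isZmodMorphism.Build A QZ _ add).
  exact: (@qz_extend A B i h inj).
pose g chi := projT1 (cid (ext chi)).
have gP chi a : g chi (i a) = val (f a) chi 1 := projT2 (cid (ext chi)) a.
have Gin b : (fun chi r => g chi (r *: b)) \in coindp.
  by rewrite unfold_in; apply/asboolP => chi r s; rewrite scalerBl raddfB.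
pose G b : coind := Coind (Gin b).
have Glin : linear G.
  move=> a u v; apply: coind_ext => chi r.
  by rewrite coind_valD coind_valZ /= scalerDr scalerA raddfD.
pose GL : {linear B -> coind} := HB.pack G (GRing.isLinear.Build R B coind *:%R G Glin).
exists GL => a; apply: coind_ext => chi r.
have -> : val (GL (i a)) chi r = g chi (r *: i a) by [].
by rewrite -linearZ /= gP linearZ coind_valZ mul1r.
Qed.

Lemma coind_emb_subproof (m : M) :
  (fun (chi : X) (r : R) => chi (r *: m)) \in coindp.
Proof. by rewrite unfold_in; apply/asboolP => chi r s; rewrite scalerBl raddfB. Qed.
Definition coind_emb_of (m : M) : coind := Coind (coind_emb_subproof m).
Lemma coind_emb_linear : linear coind_emb_of.
Proof.
move=> a u v; apply: coind_ext => chi r.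
by rewrite coind_valD coind_valZ /= scalerDr scalerA raddfD.
Qed.
HB.instance Definition _ :=
  GRing.isLinear.Build R M coind *:%R coind_emb_of coind_emb_linear.
Definition coind_emb : {linear M -> coind} := coind_emb_of.

Lemma coind_emb_inj : injective coind_emb.
Proof.
move=> u v e; apply/eqP; rewrite -subr_eq0; apply: contraT => /qz_separates[chi].
have : val (coind_emb u) chi 1 = val (coind_emb v) chi 1 by rewrite e.
by rewrite /= !scale1r raddfB => ->; rewrite subrr eqxx.
Qed.
End Coinduced.

Section StdResolution.
Variables (R : comNzRingType) (M : lmodType R).

(* cosyz n embeds in the injective module coind (cosyz n), with cokernel
   cosyz n.+1 *)
Fixpoint cosyz (n : nat) : lmodType R :=
  if n is n'.+1 then quotm (img (coind_emb (cosyz n'))) else M.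

Definition std_obj (n : nat) : lmodType R := coind (cosyz n).
Definition std_proj (n : nat) : {linear std_obj n -> cosyz n.+1} :=
  qcls (img (coind_emb (cosyz n))).
Definition std_diff (n : nat) : {linear std_obj n -> std_obj n.+1} :=
  coind_emb (cosyz n.+1) \o std_proj n.

Lemma std_diff_eq0 n z : std_diff n z = 0 <-> exists m, coind_emb (cosyz n) m = z.
Proof.
split=> [e|[m <-]].
  apply/imgP/qcls_eq0/(@coind_emb_inj _ (cosyz n.+1)).
  by rewrite linear0.
have e : std_proj n (coind_emb (cosyz n) m) = 0.
  by apply/qcls_eq0/imgP; exists m.
by rewrite /std_diff /= e linear0.
Qed.

Lemma std_exact n z : std_diff n.+1 z = 0 <-> exists y, std_diff n y = z.
Proof.
rewrite std_diff_eq0; split=> [[m <-]|[y <-]]; last by exists (std_proj n y).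
by have [y <-] := qcls_surj m; exists y.
Qed.

Lemma std_diffK n (z : std_obj n) : std_diff n.+1 (std_diff n z) = 0.
Proof. by apply/std_exact; exists z. Qed.

Definition std_resolution : injective_resolution M :=
  @InjRes R M (@Complex R std_obj std_diff std_diffK) (coind_emb M)
    (@coind_emb_inj R M) (@std_diff_eq0 0) std_exact
    (fun n => @coind_injective R (cosyz n)).
End StdResolution.

(* The i-th right derived functor of Gamma_I, computed with a fixed injective
   resolution of each module and a chosen lift of each map; any other choice
   gives canonically isomorphic modules and the same induced maps *)
Section LocalCohomology.
Variables (R : comNzRingType) (I : submodClosed R^o) (i : nat).

Definition local_cohomology (M : lmodType R) : lmodType R :=
  cohom (gamma_complex I (std_resolution M)) i.

Definition local_cohomology_map (M N : lmodType R) (f : {linear M -> N}) :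
    {linear local_cohomology M -> local_cohomology N} :=
  cohom_map (gamma_cmap I (lift f (std_resolution M) (std_resolution N))) i.
End LocalCohomology.

(* Main.v *)
(* Let q = p^e and H = H^{i+1}_I(R). The connecting map identifies the elements
   of H killed by x^q with the image of H^i_I(R/x^q), and by naturality the
   surjection R/x^q -> R/x corresponds to multiplication by x^(q-1); so the
   hypothesis says that every element of H killed by x is divisible by x^(q-1).
   As x lies in I, each u in H is killed by some x^m. By induction on m, u is
   divisible by x: x^(m-1) u is killed by x, hence equals x^m v for some v, and
   u - x v is killed by x^(m-1).
   The connecting map is made explicit by resolving R/a, for a regular, by the
   cone of multiplication by a on an injective resolution of R; uniqueness of
   lifts up to homotopy transfers the hypothesis to these resolutions. *)
Require Import Defs.
From HB Require Import structures.
From mathcomp Require Import all_boot all_order all_algebra.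
From mathcomp Require Import boolp classical_sets.

Set Implicit Arguments.
Unset Strict Implicit.
Unset Printing Implicit Defensive.
Import GRing.Theory.
Local Open Scope ring_scope.


(** * Uniqueness of lifts up to homotopy *)

Section Homotopy.
Variables (R : pzRingType) (M N : lmodType R) (f : {linear M -> N}).
Variables (E : injective_resolution M) (F : injective_resolution N).

Lemma lift_homotopy (phi psi : cmap E F) : is_lift f phi -> is_lift f psi ->
  exists s : forall n, {linear E n.+1 -> F n},
    (forall z, phi 0%N z - psi 0%N z = s 0%N (diff E 0 z)) /\
    (forall n z, phi n.+1 z - psi n.+1 z =
       s n.+1 (diff E n.+1 z) + diff F n (s n z)).
Proof.
move=> phiP psiP.
pose h n : {linear E n -> F n} := phi n \- psi n.
have hE n z : h n z = phi n z - psi n z by [].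
have hd n z : h n.+1 (diff E n z) = diff F n (h n z).
  by rewrite !hE !cmorE linearB.
(* [K] is what allows [h - d s] to be extended along the next differential of [E]; carrying it
   through the recursion makes each further step possible. *)
pose K n (s : {linear E n.+1 -> F n}) :=
  forall z, diff E n.+1 z = 0 -> h n.+1 z - diff F n (s z) = 0.
have [|s0 s0P] := @injective_extend _ _ _ _ (diff E 0) (h 0%N) (ires_inj F 0).
  by move=> z /iaug_exact[m <-]; rewrite hE phiP psiP subrr.
have K0 : K 0%N s0.
  by move=> z /ires_exact[y <-]; rewrite hd s0P subrr.
have step n (s : {linear E n.+1 -> F n}) : K n s ->
    exists k : {linear E n.+2 -> F n.+1}, K n.+1 k /\
      forall z, k (diff E n.+1 z) = h n.+1 z - diff F n (s z).
  move=> Ks; pose g : {linear E n.+1 -> F n.+1} := h n.+1 \- (diff F n \o s).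
  have [k kP] := @injective_extend _ _ _ _ (diff E n.+1) g (ires_inj F n.+1) Ks.
  have kE z : k (diff E n.+1 z) = h n.+1 z - diff F n (s z) by rewrite kP.
  exists k; split=> // z /ires_exact[y <-].
  by rewrite hd kE -linearB subKr diffK.
pose T n := {s : {linear E n.+1 -> F n} | K n s}.
pose next n (t : T n) : T n.+1 :=
  exist _ (projT1 (cid (step n _ (proj2_sig t))))
    (projT2 (cid (step n _ (proj2_sig t)))).1.
pose s := nat_rect T (exist _ s0 K0) next.
exists (fun n => proj1_sig (s n)); split=> [z|n z]; first by rewrite s0P.
have e : proj1_sig (s n.+1) (diff E n.+1 z) = h n.+1 z - diff F n (proj1_sig (s n) z).
  exact: (projT2 (cid (step n _ (proj2_sig (s n))))).2.
by rewrite e subrK.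
Qed.
End Homotopy.

(** * Functoriality of the cohomology of torsion complexes, and independence of the resolution *)

Section CohomMap.
Variables (R : pzRingType).

Lemma id_cmapE (C : complex R) n (z : C n) :
  idfun (diff C n z) = diff C n (idfun z).
Proof. by []. Qed.
Definition id_cmap (C : complex R) : cmap C C :=
  @CMap R C C (fun n => idfun : {linear C n -> C n}) (@id_cmapE C).

Lemma comp_cmapE (B C D : complex R) (g : cmap C D) (f : cmap B C) n (z : B n) :
  (g n.+1 \o f n.+1) (diff B n z) = diff D n ((g n \o f n) z).
Proof. by rewrite /= !cmorE. Qed.
Definition comp_cmap (B C D : complex R) (g : cmap C D) (f : cmap B C) : cmap B D :=
  @CMap R B D (fun n => (g n \o f n) : {linear B n -> D n}) (comp_cmapE g f).
End CohomMap.

Lemma coboundP (R : pzRingType) (C : complex R) n (w : cocycles C n) :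
  w \in cobound C n <-> is_cobound (val w).
Proof. by rewrite unfold_in; split=> /asboolP. Qed.

Lemma cohom_mapE (R : pzRingType) (C D : complex R) (f : cmap C D) n w :
  cohom_map f n (qcls (cobound C n) w) = qcls (cobound D n) (cocycle_map f n w).
Proof. exact: qmap_cls. Qed.

Section GammaCohom.
Variables (R : comNzRingType) (I : submodClosed R^o).
Local Notation "f ^*" := (gamma_cmap I f).
Local Notation Gamma C := (gamma_complex I C).

Lemma gamma_cocycle (C : complex R) n (z : C n) :
  z \in gamma_sub I (C n) -> diff C n z = 0 ->
  exists w : cocycles (Gamma C) n, val (val w) = z.
Proof.
move=> Iz dz.
have k : (Subm Iz : Gamma C n) \in ker (diff (Gamma C) n) by apply/kerP/val_inj.
by exists (Subm k).
Qed.

Lemma gamma_cocycleP (C : complex R) n (w : cocycles (Gamma C) n) :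
  val (val w) \in gamma_sub I (C n) /\ diff C n (val (val w)) = 0.
Proof.
split; first exact: (valP (val w)).
by have /kerP/(congr1 val) := valP w.
Qed.

(** Coboundaries of [gamma_complex I C] read in [C] itself, free of nested subtypes; the preimage
    [y] must itself be torsion. *)
Definition gamma_cobound (C : complex R) n : C n -> Prop :=
  match n return C n -> Prop with
  | 0%N => fun z => z = 0
  | n'.+1 => fun z => exists2 y, y \in gamma_sub I (C n') & diff C n' y = z
  end.

Lemma gamma_cls_eq (C : complex R) n (v w : cocycles (Gamma C) n) :
  qcls (cobound (Gamma C) n) v = qcls (cobound (Gamma C) n) w <->
  gamma_cobound (val (val v) - val (val w)).
Proof.
rewrite qclsP coboundP.
have <- : val (val (v - w)) = val (val v) - val (val w) by [].
move: (v - w) => u {v w}.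
case: n u => [|n] u; split.
- by move=> /= ->.
- by move=> e; apply/val_inj.
- by move=> [y /= <-]; exists (val y) => //; apply: valP.
- by move=> [y Iy e]; exists (Subm Iy); exact/val_inj.
Qed.

Lemma cohom_map_id (C : complex R) n u : cohom_map ((id_cmap C)^*) n u = u.
Proof.
have [w <-] := qcls_surj u; rewrite cohom_mapE; congr (qcls _ _).
by do 2!apply: val_inj.
Qed.

Lemma cohom_map_comp (B C D : complex R) (g : cmap C D) (f : cmap B C) n u :
  cohom_map ((comp_cmap g f)^*) n u = cohom_map (g^*) n (cohom_map (f^*) n u).
Proof.
have [w <-] := qcls_surj u; rewrite !cohom_mapE; congr (qcls _ _).
by do 2!apply: val_inj.
Qed.

(** The homotopy is linear, so it preserves [I]-torsion and restricts to the torsion complexes. *)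
Lemma cohom_map_lift (M N : lmodType R) (f : {linear M -> N})
    (E : injective_resolution M) (F : injective_resolution N) (phi psi : cmap E F) n :
  is_lift f phi -> is_lift f psi -> cohom_map (phi^*) n =1 cohom_map (psi^*) n.
Proof.
move=> phiP psiP u; have [w <-] := qcls_surj u; rewrite !cohom_mapE; apply/gamma_cls_eq.
have [s [s0 sS]] := lift_homotopy phiP psiP.
have [Iw dw] := gamma_cocycleP w; rewrite /=.
case: n u w Iw dw => [|n] u w Iw dw /=; first by rewrite s0 dw linear0.
exists (s n (val (val w))); first exact: gamma_map_subproof.
by rewrite sS dw linear0 add0r.
Qed.

(** Lifts [a], [b], [c] of identities compare the resolutions. On cohomology [psi a] agrees with
    [b phi], as both lift [f], and [b c] is the identity; so [a] carries a [phi]-preimage of [c y]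
    to a [psi]-preimage of [y]. *)
Lemma surjective_cohom_lift (M N : lmodType R) (f : {linear M -> N})
    (E E' : injective_resolution M) (F F' : injective_resolution N)
    (phi : cmap E F) (psi : cmap E' F') n :
  is_lift f phi -> is_lift f psi ->
  surjective (cohom_map (phi^*) n) -> surjective (cohom_map (psi^*) n).
Proof.
move=> phiP psiP phis y.
have aP := @liftP _ _ _ idfun E E'; have bP := @liftP _ _ _ idfun F F'.
have cP := @liftP _ _ _ idfun F' F.
set a := Defs.lift _ _ _ in aP; set b := Defs.lift _ _ _ in bP.
set c := Defs.lift _ _ _ in cP.
have [z zE] := phis (cohom_map (c^*) n y).
exists (cohom_map (a^*) n z).
rewrite -cohom_map_comp (@cohom_map_lift _ _ f _ _ _ (comp_cmap b phi)).
- rewrite cohom_map_comp zE -cohom_map_comp -[RHS]cohom_map_id.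
  by apply: (@cohom_map_lift _ _ idfun) => m //=; rewrite cP bP.
- by move=> m; rewrite /= aP psiP.
- by move=> m; rewrite /= phiP bP.
Qed.
End GammaCohom.

(** * Products and split quotients of injective modules *)

Lemma injective_prod (R : pzRingType) (E F : lmodType R) :
  injective_module E -> injective_module F -> injective_module (E * F)%type.
Proof.
move=> hE hF A B i f inj.
have [g gP] := hE A B i (fst \o f) inj; have [h hP] := hF A B i (snd \o f) inj.
have l : linear (fun b => (g b, h b)) by move=> a u v; rewrite !linearP.
exists (HB.pack (fun b => (g b, h b))
  (GRing.isLinear.Build R B (E * F)%type *:%R _ l) : {linear B -> (E * F)%type}).
by move=> a /=; rewrite gP hP /=; case: (f a).
Qed.

(** The map [t], which is [id - j r], kills [img j] and induces a section of the projection from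
    [F], so the quotient is a retract of [F]. *)
Lemma injective_quot (R : pzRingType) (E F : lmodType R)
    (j : {linear E -> F}) (r : {linear F -> E}) :
  cancel j r -> injective_module F -> injective_module (quotm (img j)).
Proof.
move=> jr hF A B i f inj.
pose t : {linear F -> F} := idfun \- (j \o r).
have t0 m : m \in img j -> t m = 0 by move/imgP=> [e <-]; rewrite /t /= jr subrr.
have [g gP] := hF A B i (qlift_lin t0 \o f) inj.
have gE a : g (i a) = qlift_lin t0 (f a) by rewrite gP.
exists (qcls (img j) \o g) => a; rewrite [LHS]/= gE.
have [m <-] := qcls_surj (f a); rewrite qlift_linE; apply/qclsP/imgP.
by exists (- r m); rewrite /t /= addrAC subrr add0r linearN.
Qed.

(** * An injective resolution of R/a built from one of R *)

Section QuotByResolution.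
Variables (R : comNzRingType) (a : R) (areg : regular_elt a).
Variable E : injective_resolution R^o.

(** The first component is the shifted source of multiplication by [a], the second its target; the
    sign makes consecutive differentials cancel. *)
Definition cone_diff_of n (u : E n.+1 * E n) : E n.+2 * E n.+1 :=
  (diff E n.+1 u.1, a *: u.1 - diff E n u.2).
Lemma cone_diff_linear n : linear (@cone_diff_of n).
Proof.
move=> b u v; congr (_, _) => /=; rewrite !linearP //=.
by rewrite addrACA !scalerA mulrC.
Qed.
HB.instance Definition _ n := GRing.isLinear.Build R (E n.+1 * E n)%type
  (E n.+2 * E n.+1)%type *:%R (@cone_diff_of n) (@cone_diff_linear n).
Definition cone_diff n : {linear (E n.+1 * E n)%type -> (E n.+2 * E n.+1)%type} :=
  @cone_diff_of n.

(** The differential of the cone out of degree -1, where the target component is absent. *)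
Definition cone_base_of (e : E 0%N) : E 1%N * E 0%N := (diff E 0 e, a *: e).
Lemma cone_base_linear : linear cone_base_of.
Proof.
by move=> b u v; congr (_, _) => /=; rewrite !linearP.
Qed.
HB.instance Definition _ := GRing.isLinear.Build R (E 0%N)
  (E 1%N * E 0%N)%type *:%R cone_base_of cone_base_linear.
Definition cone_base : {linear E 0%N -> (E 1%N * E 0%N)%type} := cone_base_of.

Lemma cone_diffE n u : cone_diff n u = (diff E n.+1 u.1, a *: u.1 - diff E n u.2).
Proof. by []. Qed.
Lemma cone_baseE e : cone_base e = (diff E 0 e, a *: e).
Proof. by []. Qed.

Lemma cone_diffK n u : cone_diff n.+1 (cone_diff n u) = 0.
Proof. by rewrite !cone_diffE /= linearB linearZ !diffK subr0 subrr. Qed.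

Lemma cone_diff_base e : cone_diff 0 (cone_base e) = 0.
Proof. by rewrite cone_diffE cone_baseE /= linearZ diffK subrr. Qed.

Lemma cone_diff_eq0 n u : cone_diff n.+1 u = 0 -> exists w, cone_diff n w = u.
Proof.
case: u => u v; rewrite cone_diffE => -[/= /ires_exact[w <-] /eqP].
rewrite -linearZ -linearB /= => /eqP/ires_exact[y yE].
by exists (w, y); rewrite cone_diffE /= yE subKr.
Qed.

(** Regularity of [a] enters here: [d e = 0] puts [e] in the image of R, on which multiplication by
    [a] is injective. *)
Lemma cone_base_inj : injective cone_base.
Proof.
apply: raddf_inj => e; rewrite -[X in X = 0]cone_baseE => -[/iaug_exact[r <-]].
by rewrite -linearZ -[RHS](linear0 (iaug E)) => /iaug_inj/areg ->; rewrite linear0.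
Qed.

(** Injectivity of [E 0] gives the splitting. It makes the degree 0 quotient injective and later
    lets torsion classes lift to torsion pairs. *)
Lemma cone_base_retraction :
  exists r : {linear (E 1%N * E 0%N)%type -> E 0%N}, cancel cone_base r.
Proof. exact: (ires_inj E 0 _ _ cone_base idfun cone_base_inj). Qed.

Lemma cone_diff0P u : cone_diff 0 u = 0 <->
  exists (r : R^o) e, u = (0, iaug E r) + cone_base e.
Proof.
split=> [|[r [e ->]]]; last first.
  rewrite linearD cone_diff_base addr0 cone_diffE /= linear0 scaler0 sub0r.
  by rewrite (@iaug_exact _ _ E _).2 ?oppr0 //; exists r.
case: u => u v; rewrite cone_diffE => -[/= /ires_exact[w <-] /eqP].
rewrite -linearZ -linearB /= => /eqP/iaug_exact[r rE].
(* The sign comes from [a w - v = iaug r], which gives [v = a w - iaug r]. *)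
exists (- r), w; rewrite cone_baseE linearN rE; congr (_, _) => /=.
  by rewrite add0r.
by rewrite opprB subrK.
Qed.

(* The cone of multiplication by a on E starts with E 0 in degree -1; as
   cone_base is a split injection, that term can be cancelled against degree 0. *)
Definition quot_by_obj (n : nat) : lmodType R :=
  match n with
  | 0%N => quotm (img cone_base)
  | n'.+1 => (E n'.+2 * E n'.+1)%type
  end.

Lemma cone_diff0_subproof u : u \in img cone_base -> cone_diff 0 u = 0.
Proof. by move/imgP=> [e <-]; apply: cone_diff_base. Qed.

Definition quot_by_diff (n : nat) : {linear quot_by_obj n -> quot_by_obj n.+1} :=
  match n with
  | 0%N => qlift_lin cone_diff0_subproof
  | n'.+1 => cone_diff n'.+1
  end.

(** Representing cochains by pairs in every degree allows computing without treating degree 0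
    apart. *)
Definition to_quot_by_obj n : {linear (E n.+1 * E n)%type -> quot_by_obj n} :=
  match n with
  | 0%N => qcls (img cone_base)
  | n'.+1 => idfun
  end.

Lemma to_quot_by_obj_surj n : surjective (to_quot_by_obj n).
Proof. by case: n => [|n] y; [apply: qcls_surj | exists y]. Qed.

Lemma quot_by_diffE n u :
  quot_by_diff n (to_quot_by_obj n u) = cone_diff n u.
Proof. by case: n u => [|n] u //; apply: qlift_linE. Qed.

Lemma quot_by_diffK n z : quot_by_diff n.+1 (quot_by_diff n z) = 0.
Proof.
have [u <-] := to_quot_by_obj_surj z; rewrite quot_by_diffE.
exact: cone_diffK.
Qed.

Lemma quot_by_exact n z : quot_by_diff n.+1 z = 0 <-> exists y, quot_by_diff n y = z.
Proof.
split=> [/(@cone_diff_eq0 n)[w <-]|[y <-]]; last exact: quot_by_diffK.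
by exists (to_quot_by_obj n w); rewrite quot_by_diffE.
Qed.

Lemma quot_by_inj n : injective_module (quot_by_obj n).
Proof.
case: n => [|n]; last by apply: injective_prod; apply: ires_inj.
have [r rK] := cone_base_retraction.
by apply: (injective_quot rK); apply: injective_prod; apply: ires_inj.
Qed.

Definition cone_aug_of (r : R^o) : E 1%N * E 0%N := (0, iaug E r).
Lemma cone_aug_linear : linear cone_aug_of.
Proof. by move=> b u v; congr (_, _) => /=; rewrite ?linearP // scaler0 addr0. Qed.
HB.instance Definition _ := GRing.isLinear.Build R R^o
  (E 1%N * E 0%N)%type *:%R cone_aug_of cone_aug_linear.
Definition cone_aug : {linear R^o -> (E 1%N * E 0%N)%type} := cone_aug_of.

(** If [(0, iaug r) = (d e, a e)], then [e = iaug c] by exactness, and [r = a c]. Hence R/a embeds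
    in degree 0. *)
Lemma cone_aug_img r : cone_aug r \in img cone_base <-> r \in principal a.
Proof.
rewrite imgP [_ \in principal a]unfold_in; split=> [[e]|/asboolP[c ->]]; last first.
  exists (iaug E c); rewrite cone_baseE (@iaug_exact _ _ E _).2; last by exists c.
  by congr (_, _); rewrite -linearZ /= mulrC.
rewrite cone_baseE => -[/iaug_exact[c <-]]; rewrite -linearZ => /iaug_inj <-.
by apply/asboolP; exists c; rewrite mulrC.
Qed.

Definition quot_by_aug : {linear quot_by a -> quot_by_obj 0} :=
  qmap (fun r => (cone_aug_img r).2).

Lemma quot_by_augE r :
  quot_by_aug (qcls (principal a) r) = qcls (img cone_base) (cone_aug r).
Proof. exact: qmap_cls. Qed.

Lemma quot_by_aug_inj : injective quot_by_aug.
Proof.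
apply: raddf_inj => u; have [r <-] := qcls_surj u.
rewrite -[X in X = 0]/(quot_by_aug (qcls (principal a) r)) quot_by_augE.
by move/qcls_eq0/cone_aug_img/qcls_eq0.
Qed.

Lemma quot_by_aug_exact z : quot_by_diff 0 z = 0 <-> exists m, quot_by_aug m = z.
Proof.
split=> [|[m <-]]; last first.
  have [r <-] := qcls_surj m; rewrite quot_by_augE (@quot_by_diffE 0).
  by apply/cone_diff0P; exists r, 0; rewrite linear0 addr0.
have [u <-] := qcls_surj z; rewrite (@quot_by_diffE 0) => /cone_diff0P[r [e ->]].
exists (qcls _ r); rewrite quot_by_augE; apply/qclsP/imgP.
by exists (- e); rewrite linearN opprD addrA subrr sub0r.
Qed.

Definition quot_by_resolution : injective_resolution (quot_by a) :=
  @InjRes R (quot_by a) (@Complex R quot_by_obj quot_by_diff quot_by_diffK)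
    quot_by_aug quot_by_aug_inj quot_by_aug_exact quot_by_exact quot_by_inj.
End QuotByResolution.

(** * Lifting the surjection from R/a to R/b to the cones, for a = c b *)

Section QuotByMap.
Variables (R : comNzRingType) (a b c : R).
Hypotheses (areg : regular_elt a) (breg : regular_elt b) (abc : a = c * b).
Variable E : injective_resolution R^o.

(** The identity on the target component, which holds the augmentation, covers the surjection;
    compatibility with [a = c b] then puts [c] on the source component. *)
Definition cone_map_of n (u : E n.+1 * E n) : E n.+1 * E n := (c *: u.1, u.2).
Lemma cone_map_linear n : linear (@cone_map_of n).
Proof. by move=> k u v; congr (_, _) => /=; rewrite !linearP. Qed.
HB.instance Definition _ n := GRing.isLinear.Build R (E n.+1 * E n)%type
  (E n.+1 * E n)%type *:%R (@cone_map_of n) (@cone_map_linear n).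
Definition cone_map n : {linear (E n.+1 * E n)%type -> (E n.+1 * E n)%type} :=
  @cone_map_of n.

Lemma cone_mapE n u : cone_map n u = (c *: u.1, u.2).
Proof. by []. Qed.

Lemma cone_map_diff n u :
  cone_map n.+1 (cone_diff a E n u) = cone_diff b E n (cone_map n u).
Proof. by rewrite !cone_mapE !cone_diffE /= linearZ scalerA mulrC abc. Qed.

Lemma cone_map_base u : u \in img (cone_base a E) -> cone_map 0 u \in img (cone_base b E).
Proof.
move/imgP=> [e <-]; apply/imgP; exists (c *: e).
by rewrite cone_mapE !cone_baseE /= linearZ scalerA mulrC abc.
Qed.

Definition quot_by_map n : {linear quot_by_obj a E n -> quot_by_obj b E n} :=
  match n with
  | 0%N => qmap cone_map_base
  | n'.+1 => cone_map n'.+1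
  end.

Lemma quot_by_mapE n u :
  quot_by_map n (to_quot_by_obj a E n u) = to_quot_by_obj b E n (cone_map n u).
Proof. by case: n u => [|n] u //; apply: qmap_cls. Qed.

Lemma quot_by_map_diff n z : quot_by_map n.+1 (quot_by_diff a E n z) =
  quot_by_diff b E n (quot_by_map n z).
Proof.
have [u <-] := to_quot_by_obj_surj z.
by rewrite quot_by_mapE !quot_by_diffE -cone_map_diff.
Qed.

Definition quot_by_cmap :
    cmap (quot_by_resolution areg E) (quot_by_resolution breg E) :=
  @CMap R (quot_by_resolution areg E) (quot_by_resolution breg E)
    quot_by_map quot_by_map_diff.

Lemma quot_by_cmap_lift (f : {linear quot_by a -> quot_by b}) :
  (forall r, f (qcls (principal a) r) = qcls (principal b) r) ->
  is_lift f quot_by_cmap.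
Proof.
move=> fE m; have [r <-] := qcls_surj m.
rewrite fE [iaug _ _]quot_by_augE [iaug _ _]quot_by_augE.
rewrite [LHS](@quot_by_mapE 0); congr (qcls _ _).
by rewrite cone_mapE /= scaler0.
Qed.
End QuotByMap.

(** * Torsion in the resolution of R/a, and the connecting map *)

Section GammaQuotBy.
Variables (R : comNzRingType) (I : submodClosed R^o).

Lemma gamma_pair (M N : lmodType R) (u : M) (v : N) :
  u \in gamma_sub I M -> v \in gamma_sub I N -> (u, v) \in gamma_sub I (M * N)%type.
Proof.
rewrite !unfold_in => /asboolP[m hm] /asboolP[n hn]; apply/asboolP.
exists (m + n)%N => a Ia.
congr (_, _) => /=; [apply: hm | apply: hn]; apply: (ideal_pow_le _ Ia).
  exact: leq_addr.
exact: leq_addl.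
Qed.

Variables (a : R) (areg : regular_elt a) (E : injective_resolution R^o).
Local Notation K := (quot_by_resolution areg E).

(** Torsion of a quotient need not lift in general; in degree 0 the retraction yields a linear
    section, and linear maps preserve torsion. *)
Lemma gamma_quot_by_lift n (y : K n) : y \in gamma_sub I (K n) ->
  exists2 u, u \in gamma_sub I (E n.+1 * E n)%type & to_quot_by_obj a E n u = y.
Proof.
case: n y => [|n] y Iy; last by exists y.
have [r rK] := cone_base_retraction areg E.
pose t : {linear (E 1%N * E 0%N)%type -> (E 1%N * E 0%N)%type} :=
  idfun \- (cone_base a E \o r).
have tE u : t u = u - cone_base a E (r u) by [].
have t0 m : m \in img (cone_base a E) -> t m = 0.
  by move/imgP=> [e <-]; rewrite tE rK subrr.
exists (qlift_lin t0 y); first exact: gamma_map_subproof.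
have [u <-] := qcls_surj y; rewrite qlift_linE tE; apply/qclsP/imgP.
by exists (- r u); rewrite addrAC subrr add0r linearN.
Qed.

(** Taking first components is the connecting map into degree [n.+1]; this makes it well defined on
    classes. *)
Lemma gamma_cobound_quot_by n u : u \in gamma_sub I (E n.+1 * E n)%type ->
  gamma_cobound I (to_quot_by_obj a E n u : K n) ->
  exists2 e, e \in gamma_sub I (E n) & diff E n e = u.1.
Proof.
case: n u => [|n] u Iu.
  have [r rK] := cone_base_retraction areg E.
  move/qcls_eq0/imgP=> [e eu]; exists e; last by rewrite -eu.
  by rewrite -(rK e) eu; apply: gamma_map_subproof.
move=> [_ /gamma_quot_by_lift[w Iw <-]]; rewrite [LHS]quot_by_diffE => wu.
by exists w.1; [exact: (@gamma_map_subproof _ I _ _ fst) | rewrite -[u]wu].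
Qed.
End GammaQuotBy.

(** Represent [u] by [z] with [b z = d v]. Then [(z, v)] is a cocycle of the cone of [b] whose
    connecting image is [u]. By surjectivity it is cohomologous to the image of a cocycle from the
    cone of [a], and [cone_map] multiplies first components by [c]. *)
Lemma cohom_ker_sub_image (R : comNzRingType) (I : submodClosed R^o) (a b c : R)
    (areg : regular_elt a) (breg : regular_elt b) (abc : a = c * b)
    (E : injective_resolution R^o) (n : nat) :
  surjective (cohom_map (gamma_cmap I (quot_by_cmap areg breg abc E)) n) ->
  forall u : cohom (gamma_complex I E) n.+1, b *: u = 0 -> exists v, c *: v = u.
Proof.
move=> surj u; have [w <-] := qcls_surj u.
have [Iz dz] := gamma_cocycleP w; set z := val (val w) in Iz dz.
rewrite -linearZ -(linear0 (qcls (cobound (gamma_complex I E) n.+1))).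
move=> /gamma_cls_eq; rewrite [X in gamma_cobound I X]subr0 => -[v Iv].
rewrite [RHS](_ : _ = b *: z) // => dv.
set K := quot_by_resolution breg E in surj.
pose k : K n := to_quot_by_obj b E n (z, v).
have Ik : k \in gamma_sub I (K n) by apply/gamma_map_subproof/gamma_pair.
have dk : diff K n k = 0.
  by rewrite [LHS]quot_by_diffE cone_diffE dz dv; congr (_, _); apply: subrr.
have [t tk] := gamma_cocycle Ik dk.
have [s] := surj (qcls _ t); have [{}s <-] := qcls_surj s.
rewrite cohom_mapE => /gamma_cls_eq; rewrite tk.
have [Iy dy] := gamma_cocycleP s.
have [y' Iy' yE] := gamma_quot_by_lift Iy.
have sE :
    val (val (cocycle_map (gamma_cmap I (quot_by_cmap areg breg abc E)) n s)) - k =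
    to_quot_by_obj b E n (cone_map c E n y' - (z, v)).
  by rewrite linearB -(quot_by_mapE abc) yE.
(* Comparing first components: [c *: y'.1 - z] is the differential of the torsion element [e]. *)
rewrite sE => /gamma_cobound_quot_by[|e Ie eE].
  by apply: rpredB; [apply: gamma_map_subproof | apply: gamma_pair].
have du : diff E n.+1 y'.1 = 0.
  by move: dy; rewrite -yE [LHS]quot_by_diffE cone_diffE => -[].
have [q qE] := gamma_cocycle (@gamma_map_subproof _ I _ _ fst _ Iy') du.
exists (qcls _ q); rewrite -linearZ; apply/gamma_cls_eq; exists e => //.
by rewrite eE /= qE.
Qed.

(** * Divisibility of torsion modules, and the conclusion *)

Lemma torsion_divisible (R : comNzRingType) (H : lmodType R) (x : R) :
  (forall u : H, exists m : nat, x ^+ m *: u = 0) ->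
  (forall (m : nat) (u : H), x *: u = 0 -> exists v, x ^+ m *: v = u) ->
  surjective (fun u : H => x *: u).
Proof.
move=> tors div u; have [m] := tors u.
elim: m u => [|m IH] u xu.
  by exists 0; rewrite -[u]scale1r -[1](expr0 x) xu scaler0.
have [|v vE] := div m.+1 (x ^+ m *: u); first by rewrite scalerA -exprS.
have [|w wE] := IH (u - x *: v); first by rewrite scalerBr scalerA -exprSr vE subrr.
by exists (w + v); rewrite scalerDr wE subrK.
Qed.

Lemma ideal_pow_exp (R : comNzRingType) (A : set R) (x : R) n :
  A x -> ideal_pow A n (x ^+ n).
Proof.
move=> Ax; elim: n => // n IH; exists [:: (x, x ^+ n)].
  by move=> ab; rewrite inE => /eqP ->.
by rewrite big_seq1 exprS.
Qed.

(** A torsion cocycle is killed by some power [m] of [I], and that power contains [x ^+ m]. *)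
Lemma gamma_cohom_torsion (R : comNzRingType) (I : submodClosed R^o) (x : R)
    (C : complex R) n (u : cohom (gamma_complex I C) n) :
  x \in I -> exists m, x ^+ m *: u = 0.
Proof.
move=> xI; have [w <-] := qcls_surj u.
have [] := gamma_cocycleP w; rewrite unfold_in => /asboolP[m wm] _; exists m.
rewrite -linearZ.
have -> : x ^+ m *: w = 0 by do 2!apply: val_inj; apply/wm/ideal_pow_exp.
exact: linear0.
Qed.

Lemma regular_exp (R : comNzRingType) (x : R) n :
  regular_elt x -> regular_elt (x ^+ n).
Proof.
move=> xreg; elim: n => [|n IH] y; first by rewrite mul1r.
by rewrite exprS -mulrA => /xreg/IH.
Qed.

Theorem proposition3p15
    (R : comNzRingType) (noethR : noetherian R) (locR : local_ring R)
    (p : nat) (pR : p \in [pchar R])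
    (I : submodClosed R^o) (x : R) (xI : x \in I) (xreg : regular_elt x)
    (i : nat)
    (hsurj : forall e : nat,
       surjective (local_cohomology_map I i (frob_proj pR x e))) :
  surjective (fun u : local_cohomology I i.+1 R^o => x *: u).
Proof.
apply: torsion_divisible => [u|m u xu]; first exact: gamma_cohom_torsion.
(* The choice [e = m] suffices: [m <= p ^ m - 1], so divisibility by [x ^+ (p ^ m).-1] gives
   divisibility by [x ^+ m]. *)
have mp : (m < p ^ m)%N by rewrite ltn_expl // prime_gt1 // (pcharf_prime pR).
have xE : x ^+ (p ^ m) = x ^+ (p ^ m).-1 * x.
  by rewrite -exprSr prednK // (leq_ltn_trans _ mp).
have xqreg := regular_exp (n := p ^ m) xreg.
(* With this [E], the cohomology of [gamma_complex I E] is by definition the local cohomology of R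
   in the goal. *)
pose E := std_resolution R^o.
have surj : surjective (cohom_map (gamma_cmap I (quot_by_cmap xqreg xreg xE E)) i).
  apply: (surjective_cohom_lift _ _ (hsurj m)); first exact: liftP.
  by apply: quot_by_cmap_lift => r; apply: frob_proj_cls.
have [v <-] := cohom_ker_sub_image surj xu.
exists (x ^+ ((p ^ m).-1 - m) *: v).
by rewrite scalerA -exprD subnKC // -ltnS prednK // (leq_ltn_trans _ mp).
Qed.
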